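(* Suppose $R$ is an integral domain. Then $R$ is a discrete valuation ring (DVR) if and only if $R$ is a strongly local Noetherian domain.
   Context: All rings are commutative with unity. A ring is called strongly local if it is local (has exactly one maximal ideal) and there is a largest proper nonmaximal ideal $\mathfrak{n}$, i.e. a proper nonmaximal ideal $\mathfrak{n}$ such that all proper nonmaximal ideals are contained in $\mathfrak{n}$. A discrete valuation of a field $K$ is a surjective group homomorphism $v\colon K^\times \to \mathbb{Z}$ (from the multiplicative group of $K$ to the additive group $\mathbb{Z}$) such that $v(x+y)\ge \min\{v(x),v(y)\}$ for all $x,y\in K^\times$ with $x+y\neq 0$; by convention $v(0)=\infty$. A discrete valuation ring (DVR) is any ring of the form $\mathcal{O}_v=\{x\in K \mid v(x)\ge 0\}$, where $K$ is a field and $v$ is a discrete valuation of $K$. *)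

(* Defs.v *)
From mathcomp Require Export all_boot all_order all_algebra.
From mathcomp Require Export boolp classical_sets.

Set Implicit Arguments.
Unset Strict Implicit.
Unset Printing Implicit Defensive.
Import Order.TTheory GRing.Theory Num.Theory.
Local Open Scope classical_set_scope.
Local Open Scope ring_scope.

(* Ideals are Prop-valued sets, so that quantifying over ideals is not
   restricted to boolean predicates as it is in ring_quotient. *)
Definition is_ideal (R : comNzRingType) (I : set R) : Prop :=
  [/\ I 0,
      forall x y, I x -> I y -> I (x + y)
    & forall a x, I x -> I (a * x)].

Definition is_proper_ideal (R : comNzRingType) (I : set R) : Prop :=
  is_ideal I /\ I <> setT.

Definition is_maximal_ideal (R : comNzRingType) (m : set R) : Prop :=
  is_proper_ideal m /\
  forall I : set R, is_proper_ideal I -> m `<=` I -> I = m.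

Definition is_local (R : comNzRingType) : Prop :=
  exists! m : set R, is_maximal_ideal m.

Definition is_proper_nonmaximal_ideal (R : comNzRingType) (I : set R) : Prop :=
  is_proper_ideal I /\ ~ is_maximal_ideal I.

Definition is_strongly_local (R : comNzRingType) : Prop :=
  is_local R /\
  exists n : set R,
    is_proper_nonmaximal_ideal n /\
    forall I : set R, is_proper_nonmaximal_ideal I -> I `<=` n.

Definition is_noetherian (R : comNzRingType) : Prop :=
  forall I : nat -> set R,
    (forall n, is_ideal (I n)) ->
    (forall n, I n `<=` I n.+1) ->
    exists N : nat, forall n, (N <= n)%N -> I n = I N.

(* A valuation is a total function whose value at 0 is irrelevant: all the
   conditions are restricted to nonzero elements, and the convention
   v 0 = oo is built into valuation_ring. *)
Definition is_discrete_valuation (K : fieldType) (v : K -> int) : Prop :=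
  [/\ forall x y : K, x != 0 -> y != 0 -> v (x * y) = v x + v y,
      forall k : int, exists2 x : K, x != 0 & v x = k
    & forall x y : K, x != 0 -> y != 0 -> x + y != 0 ->
        Num.min (v x) (v y) <= v (x + y)].

Definition valuation_ring (K : fieldType) (v : K -> int) : set K :=
  [set x | x = 0 \/ 0 <= v x].

(* R is isomorphic to the subring valuation_ring v of K; the isomorphism is
   given as an injective ring morphism into K with image valuation_ring v. *)
Definition is_dvr (R : comNzRingType) : Prop :=
  exists (K : fieldType) (v : K -> int) (f : {rmorphism R -> K}),
    [/\ is_discrete_valuation v, injective f & range f = valuation_ring v].

(* Main.v *)
Require Import Defs.
From mathcomp Require Import all_boot all_order all_algebra.
From mathcomp Require Import boolp classical_sets.
From mathcomp Require Import generic_quotient.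

(** Both conditions amount to the existence of a uniformizer: a nonzero nonunit
    [t] such that every nonzero element is a unit times a power of [t].

    In a discrete valuation ring an element of value 1 is a uniformizer
    ([dvr_uniformizer]).  Conversely, in the fraction field every nonzero
    element is [u * t ^ n] for a unit [u] and exactly one integer [n], and
    this [n] is a discrete valuation whose ring is [R] ([uniformizer_dvr]).

    Given a uniformizer, the ideals are 0 and the powers of [(t)].  All are
    principal, so the ring is Noetherian ([uniformizer_noetherian]); [(t)] is
    the only maximal ideal and [(t ^+ 2)] the largest proper nonmaximal one
    ([uniformizer_strongly_local]).

    Conversely, let [m] be the maximal ideal and [n] the largest proper
    nonmaximal ideal.  Then [n] is strictly smaller than [m], and any [t] in
    [m] but not in [n] generates [m], since [(t)] is proper and not contained
    in [n].  The chain condition bounds the powers of [t] that divide a given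
    nonzero element ([noetherian_bounded_power]), and the cofactor of the
    largest such power is a unit, because [t] divides every nonunit
    ([strongly_local_uniformizer]).  A field is excluded because its only
    proper ideal is maximal. *)

Set Implicit Arguments.
Unset Strict Implicit.
Unset Printing Implicit Defensive.
Import Order.TTheory GRing.Theory Num.Theory.
Local Open Scope classical_set_scope.
Local Open Scope ring_scope.

(** * Ideals *)

Definition principal_ideal (R : comNzRingType) (x : R) : set R :=
  [set a | exists b, a = b * x].

Lemma principal_is_ideal (R : comNzRingType) (x : R) :
  is_ideal (principal_ideal x).
Proof.
split=> [|_ _ [b ->] [c ->]|a _ [b ->]].
- by exists 0; rewrite mul0r.
- by exists (b + c); rewrite mulrDl.
- by exists (a * b); rewrite mulrA.
Qed.

Lemma mem_principal_ideal (R : comNzRingType) (x : R) : principal_ideal x x.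
Proof. by exists 1; rewrite mul1r. Qed.

Lemma principal_ideal_sub (R : comNzRingType) (I : set R) (x : R) :
  is_ideal I -> I x -> principal_ideal x `<=` I.
Proof. by case=> _ _ Imul Ix _ [b ->]; apply: Imul. Qed.

Lemma is_ideal1 (R : comNzRingType) (I : set R) :
  is_ideal I -> I 1 -> I = setT.
Proof.
case=> _ _ Imul I1; apply/seteqP; split=> // a _.
by rewrite -[a]mulr1; apply: Imul.
Qed.

Lemma proper_ideal_nonunit (R : idomainType) (I : set R) (a : R) :
  is_proper_ideal I -> I a -> a \isn't a GRing.unit.
Proof.
move=> [idI IT] Ia; apply/negP => ua; apply: IT; apply: is_ideal1 => //.
by case: idI => _ _ Imul; rewrite -(mulVr ua); apply: Imul.
Qed.

Lemma principal_ideal_proper (R : idomainType) (x : R) :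
  x \isn't a GRing.unit -> is_proper_ideal (principal_ideal x).
Proof.
move=> nux; split; first exact: principal_is_ideal.
move=> xT; have [b bx] : principal_ideal x 1 by rewrite xT.
by move/negP: nux; apply; apply/unitrPr; exists b; rewrite mulrC -bx.
Qed.

Lemma chain_subset (T : Type) (I : nat -> set T) :
  (forall n, I n `<=` I n.+1) ->
  forall m n, (m <= n)%N -> I m `<=` I n.
Proof.
move=> incr m n /subnKC <-; elim: (n - m)%N => [|k IHk]; first by rewrite addn0.
by rewrite addnS; apply: subset_trans IHk (incr _).
Qed.

(** The union of an ascending chain is an ideal, and the chain is constant as
    soon as it has caught a generator of its union. *)
Lemma principal_noetherian (R : comNzRingType) :
  (forall I : set R, is_ideal I -> exists x, I = principal_ideal x) ->
  is_noetherian R.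
Proof.
move=> principal I idI incr; have mono := chain_subset incr.
have idU : is_ideal [set a | exists n, I n a].
  split=> [|a b [m Ia] [n Ib]|a b [n Ib]].
  - by exists 0; case: (idI 0).
  - exists (maxn m n); case: (idI (maxn m n)) => _ Iadd _.
    by apply: Iadd; [move: Ia|move: Ib]; apply: mono;
      rewrite ?leq_maxl ?leq_maxr.
  - by exists n; case: (idI n) => _ _ Imul; apply: Imul.
have [x Ux] := principal _ idU.
have [N INx] : [set a | exists n, I n a] x.
  by rewrite Ux; apply: mem_principal_ideal.
exists N => n leNn; apply/seteqP; split; last exact: mono.
move=> a Ia; apply: (principal_ideal_sub (idI N) INx).
by rewrite -Ux; exists n.
Qed.

(** * Uniformizers *)

Definition is_uniformizer (R : idomainType) (t : R) : Prop :=
  [/\ t != 0, t \isn't a GRing.unit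
    & forall a, a != 0 ->
        exists2 u, u \is a GRing.unit & exists k : nat, a = u * t ^+ k].

(** The generator is the least power of the uniformizer in the ideal. *)
Lemma uniformizer_principal (R : idomainType) (t : R) (I : set R) :
  is_uniformizer t -> is_ideal I -> exists x, I = principal_ideal x.
Proof.
move=> [_ _ tP] idI.
have pow u k : u \is a GRing.unit -> I (u * t ^+ k) -> I (t ^+ k).
  by case: idI => _ _ Imul uu Iuk; rewrite -(mulKr uu (t ^+ k)); apply: Imul.
have [[k0 Ik0]|nopow] := pselect (exists k, I (t ^+ k)).
  have exk : exists k, `[< I (t ^+ k) >] by exists k0; apply/asboolP.
  case: (ex_minnP exk) => k /asboolP Ik kmin.
  exists (t ^+ k); apply/seteqP; split; last exact: principal_ideal_sub.
  move=> a Ia; have [->|a0] := eqVneq a 0; first by exists 0; rewrite mul0r.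
  have [u uu [j aE]] := tP a a0.
  have lekj : (k <= j)%N.
    by apply: kmin; apply/asboolP; apply: pow uu _; rewrite -aE.
  by exists (u * t ^+ (j - k)); rewrite -mulrA -exprD subnK.
exists 0; apply/seteqP; split; last first.
  by apply: principal_ideal_sub => //; case: idI.
move=> a Ia; have [->|a0] := eqVneq a 0; first exact: mem_principal_ideal.
have [u uu [j aE]] := tP a a0.
by case: nopow; exists j; apply: pow uu _; rewrite -aE.
Qed.

Lemma uniformizer_noetherian (R : idomainType) (t : R) :
  is_uniformizer t -> is_noetherian R.
Proof.
by move=> ut; apply: principal_noetherian => I; apply: uniformizer_principal ut.
Qed.

Lemma uniformizer_proper_sub (R : idomainType) (t : R) (I : set R) :
  is_uniformizer t -> is_proper_ideal I -> I `<=` principal_ideal t.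
Proof.
move=> [_ _ tP] pI a Ia; have [->|a0] := eqVneq a 0.
  by exists 0; rewrite mul0r.
have [u uu [[|k] aE]] := tP a a0.
  by have := proper_ideal_nonunit pI Ia; rewrite aE mulr1 uu.
by exists (u * t ^+ k); rewrite aE exprSr mulrA.
Qed.

(** The largest proper nonmaximal ideal is [(t ^+ 2)], as an element outside of
    it is a unit or a unit multiple of [t]. *)
Lemma uniformizer_strongly_local (R : idomainType) (t : R) :
  is_uniformizer t -> is_strongly_local R.
Proof.
move=> ut; have [t0 nut tP] := ut.
have pt := principal_ideal_proper nut.
have maxt : is_maximal_ideal (principal_ideal t).
  by split=> // I pI tI; apply/seteqP; split=> //; apply: uniformizer_proper_sub.
have nut2 : t ^+ 2 \isn't a GRing.unit by rewrite unitrX_pos.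
split.
  exists (principal_ideal t); split=> // m [pm mmax].
  by apply: mmax => //; apply: uniformizer_proper_sub.
exists (principal_ideal (t ^+ 2)); split; first split.
- exact: principal_ideal_proper.
- move=> [_ /(_ _ pt) max2].
  have [b tE] : principal_ideal (t ^+ 2) t.
    rewrite -max2; first exact: mem_principal_ideal.
    apply: principal_ideal_sub; first exact: principal_is_ideal.
    by exists t; rewrite expr2.
  rewrite expr2 mulrA in tE; move/negP: nut; apply; apply/unitrPr; exists b.
  have bt1 : b * t = 1 by apply: (mulIf t0); rewrite mul1r.
  by rewrite [t * b]mulrC.
- move=> I [pI nmaxI] a Ia; have [->|a0] := eqVneq a 0.
    by exists 0; rewrite mul0r.
  have [u uu [[|[|k]] aE]] := tP a a0.
  + by have := proper_ideal_nonunit pI Ia; rewrite aE mulr1 uu.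
  + case: nmaxI; suff -> : I = principal_ideal t by [].
    apply/seteqP; split; first exact: uniformizer_proper_sub.
    case: (pI) => idI _; apply: principal_ideal_sub => //.
    rewrite -(mulKr uu t); case: idI => _ _ Imul; apply: Imul.
    by rewrite -[t]expr1 -aE.
  + by exists (u * t ^+ k); rewrite aE -mulrA -exprD addn2.
Qed.

(** The ideals [(a : t ^+ k)] increase with [k].  If [t ^+ k] divided [a] for
    every [k], their stabilization at [N] would turn [a = t ^+ N.+1 * b] into
    [t ^+ N * b = c * a], whence [c * t = 1]. *)
Lemma noetherian_bounded_power (R : idomainType) (t a : R) :
  is_noetherian R -> t \isn't a GRing.unit -> a != 0 ->
  exists k, forall b, a <> b * t ^+ k.
Proof.
move=> noeth nut a0.
pose I k : set R := [set y | principal_ideal a (y * t ^+ k)].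
have idI k : is_ideal (I k).
  rewrite /I; case: (principal_is_ideal a) => Z A M.
  split=> [|x y Ix Iy|c x Ix] /=.
  - by rewrite mul0r.
  - by rewrite mulrDl; apply: A.
  - by rewrite -mulrA; apply: M.
have incr k : I k `<=` I k.+1.
  case: (principal_is_ideal a) => _ _ M y Iy.
  by rewrite /I /= exprS mulrCA; apply: M.
have [N stabN] := noeth I idI incr.
exists N.+1 => b aE.
(* As [a = b * t ^+ N.+1], the cofactor [b] is in [I N.+1 = I N]. *)
have [c bE] : I N b.
  by rewrite -(stabN N.+1 (leqnSn N)) /I /= -aE; apply: mem_principal_ideal.
move/negP: nut; apply; apply/unitrPr; exists c.
have ct1 : c * t = 1.
  apply: (mulIf a0).
  by rewrite mul1r {2}aE exprSr mulrA bE -!mulrA [t * a]mulrC.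
by rewrite [t * c]mulrC.
Qed.

(** Divide out of [a] the largest power of [t]; a nonunit cofactor would be
    divisible by [t] once more. *)
Lemma noetherian_uniformizer (R : idomainType) (t : R) :
  is_noetherian R -> t != 0 -> t \isn't a GRing.unit ->
  (forall a, a \isn't a GRing.unit -> principal_ideal t a) ->
  is_uniformizer t.
Proof.
move=> noeth t0 nut tdiv; split=> // a a0.
have [k0 nk0] := noetherian_bounded_power noeth nut a0.
have exk : exists k, `[< forall b, a <> b * t ^+ k >].
  by exists k0; apply/asboolP.
case: (ex_minnP exk) => -[|k] /asboolP nk kmin.
  by case: (nk a); rewrite mulr1.
have [b aE] : exists b, a = b * t ^+ k.
  apply: contrapT => nb; suff : (k < k)%N by rewrite ltnn.
  by apply: kmin; apply/asboolP => b aE; apply: nb; exists b.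
exists b; last by exists k.
apply/negPn/negP => /tdiv [c bE].
by case: (nk c); rewrite aE bE exprS mulrA.
Qed.

(** Every proper ideal strictly above [n] is maximal; as [n] is not, one such
    ideal exists, so [n] lies strictly below the maximal ideal [m].  Any [t] in
    [m] outside of [n] generates a proper ideal not below [n], which can only
    be [m]; the same dichotomy puts every nonunit into [m]. *)
Lemma strongly_local_uniformizer (R : idomainType) :
  is_strongly_local R -> is_noetherian R -> exists t : R, is_uniformizer t.
Proof.
move=> [[m [maxm muniq]] [n [[pn nmaxn] nlargest]]] noeth.
have ideal_dichotomy (I : set R) : is_proper_ideal I -> I = m \/ I `<=` n.
  move=> pI; have [maxI|nmaxI] := pselect (is_maximal_ideal I).
    by left; rewrite (muniq I).
  by right; apply: nlargest.
have nm : n `<=` m.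
  apply: contrapT => nnm; apply: nmaxn; split=> // I pI nI.
  have [Im|In] := ideal_dichotomy I pI; first by case: nnm; rewrite -Im.
  by apply/seteqP.
have [t mt nnt] : exists2 t, m t & ~ n t.
  apply: contrapT => nex; apply: nmaxn; suff -> : n = m by [].
  apply/seteqP; split=> // t mt; apply: contrapT => nt.
  by apply: nex; exists t.
exists t.
have [pm _] := maxm.
have nut := proper_ideal_nonunit pm mt.
have tm : principal_ideal t = m.
  have [//|tn] := ideal_dichotomy _ (principal_ideal_proper nut).
  by case: nnt; apply: tn; apply: mem_principal_ideal.
apply: noetherian_uniformizer => //.
  by apply/eqP => t0; apply: nnt; rewrite t0; case: pn => -[].
move=> a nua; rewrite tm.
have [<-|an] := ideal_dichotomy _ (principal_ideal_proper nua).
  exact: mem_principal_ideal.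
by apply: nm; apply: an; apply: mem_principal_ideal.
Qed.

(** * Discrete valuations *)

Lemma valuation1 (K : fieldType) (v : K -> int) :
  is_discrete_valuation v -> v 1 = 0.
Proof.
case=> vM _ _; apply: (addrI (v 1)).
by rewrite addr0 -vM ?oner_eq0 // mul1r.
Qed.

Lemma valuationV (K : fieldType) (v : K -> int) (x : K) :
  is_discrete_valuation v -> x != 0 -> v x^-1 = - v x.
Proof.
move=> dv x0; have [vM _ _] := dv; apply: (addrI (v x)).
by rewrite -vM ?invr_eq0 // divff // subrr valuation1.
Qed.

Lemma valuationX (K : fieldType) (v : K -> int) (x : K) (k : nat) :
  is_discrete_valuation v -> x != 0 -> v (x ^+ k) = v x *+ k.
Proof.
move=> dv x0; have [vM _ _] := dv; elim: k => [|k IHk].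
  by rewrite expr0 mulr0n valuation1.
by rewrite exprS mulrS vM ?expf_neq0 // IHk.
Qed.

(** An element of value 1 is a uniformizer, because the elements of value 0
    have their inverse in the valuation ring. *)
Lemma dvr_uniformizer (R : idomainType) :
  is_dvr R -> exists t : R, is_uniformizer t.
Proof.
move=> [K [v [f [dv injf rangef]]]]; have [vM vsurj _] := dv.
have f0 a : a != 0 -> f a != 0.
  by move=> a0; rewrite -(rmorph0 f) (inj_eq injf).
have v_ge0 a : a != 0 -> 0 <= v (f a).
  move=> a0; have : valuation_ring v (f a) by rewrite -rangef; exists a.
  by case=> // /eqP; rewrite (negPf (f0 a a0)).
have lift x : 0 <= v x -> exists a, f a = x.
  move=> vx; have [a _ <-] : range f x by rewrite rangef; right.
  by exists a.
have [x x0 vx1] := vsurj 1.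
have [t ft] : exists t, f t = x by apply: lift; rewrite vx1.
have t0 : t != 0 by apply: contraNneq x0 => t0; rewrite -ft t0 rmorph0.
exists t; split=> //.
  apply/negP => ut; have tV0 : t^-1 != 0 by rewrite invr_eq0.
  have := v_ge0 _ tV0; rewrite rmorphV // valuationV ?f0 // ft vx1.
  by [].
move=> a a0; case vaE : (v (f a)) (v_ge0 a a0) => [k|] // _.
have xk0 : x ^+ k != 0 by rewrite expf_neq0.
have y0 : f a / x ^+ k != 0 by rewrite mulf_neq0 ?invr_eq0 ?f0.
have vy : v (f a / x ^+ k) = 0.
  by rewrite vM ?f0 ?invr_eq0 // valuationV // valuationX // vaE vx1 natz subrr.
have [u fu] : exists u, f u = f a / x ^+ k by apply: lift; rewrite vy.
have [w fw] : exists w, f w = (f a / x ^+ k)^-1.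
  by apply: lift; rewrite valuationV // vy.
exists u.
  have uw : u * w = 1 by apply: injf; rewrite rmorphM fu fw divff // rmorph1.
  by apply/unitrPr; exists w.
by exists k; apply: injf; rewrite rmorphM rmorphXn /= ft fu divfK.
Qed.

Local Notation tofrac := (@FracField.tofrac _).

Lemma fraction_div (R : idomainType) (z : {fraction R}) :
  exists a, exists2 b, b != 0 & z = tofrac a / tofrac b.
Proof.
elim/quotW: z => r; exists (frac r).1, (frac r).2; first exact: denom_ratioP.
have d0 : (frac r).2 != 0 by exact: denom_ratioP.
apply: (canRL (mulfK _)); first by rewrite tofrac_eq0.
unlock FracField.tofrac; rewrite -[LHS]FracField.pi_mul.
apply/eqmodP; rewrite /= FracField.equivfE /FracField.mulf.
by rewrite !numden_Ratio ?mulr1 ?oner_eq0 // mulrC.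
Qed.

(** The graph of the valuation defined by [t]; a relation, so that values are
    obtained by exhibiting a factorization. *)
Definition has_order (R : idomainType) (t : R) (z : {fraction R}) : set int :=
  [set n | exists2 u, u \is a GRing.unit & z = tofrac u * tofrac t ^ n].

Section Order.
Variables (R : idomainType) (t : R).
Hypothesis ut : is_uniformizer t.

Let t0 : tofrac t != 0.
Proof. by case: ut => t0 _ _; rewrite tofrac_eq0. Qed.

Lemma has_order_tofrac a : a != 0 -> exists k : nat, has_order t (tofrac a) k.
Proof.
case: ut => _ _ tP /tP [u uu [k ->]]; exists k, u => //.
by rewrite tofracM tofracXn.
Qed.

Lemma has_orderM z w m n :
  has_order t z m -> has_order t w n -> has_order t (z * w) (m + n).
Proof.
move=> [a ua ->] [b ub ->]; exists (a * b); first by rewrite unitrM ua.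
by rewrite tofracM expfzDr // mulrACA.
Qed.

Lemma has_orderV z n : has_order t z n -> has_order t z^-1 (- n).
Proof.
move=> [a ua ->]; exists a^-1; first by rewrite unitrV.
by rewrite rmorphV // invfM invr_expz.
Qed.

Lemma has_order_ex z : z != 0 -> exists n, has_order t z n.
Proof.
have [a [b b0 ->]] := fraction_div z; rewrite mulf_eq0 negb_or => /andP[a0 _].
rewrite tofrac_eq0 in a0.
have [m za] := has_order_tofrac a0; have [n zb] := has_order_tofrac b0.
by exists (m%:Z - n%:Z); apply: has_orderM za (has_orderV zb).
Qed.

(** A negative order [- k.+1] would make [t ^+ k.+1] divide a unit. *)
Lemma has_order_ge0 a n : has_order t (tofrac a) n -> 0 <= n.
Proof.
case: ut => _ nut _; case: n => [//|k] [u uu aE].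
suff : t ^+ k.+1 \is a GRing.unit by rewrite unitrX_pos // (negPf nut).
have uE : a * t ^+ k.+1 = u.
  apply/eqP; rewrite -tofrac_eq tofracM tofracXn aE NegzE -exprnN.
  by rewrite divfK // expf_neq0.
by move: uu; rewrite -uE unitrM => /andP[].
Qed.

(** Dividing the two factorizations of [z] shows that the unit [a / b] of [R]
    has order [n - m]. *)
Lemma has_order_le z m n : has_order t z m -> has_order t z n -> m <= n.
Proof.
move=> [a ua zE] [b ub zE']; rewrite -subr_ge0; apply: (@has_order_ge0 (a / b)).
exists 1; first exact: unitr1.
rewrite rmorph1 mul1r expfzDr // -invr_expz tofracM rmorphV //.
have b0 : tofrac b != 0.
  by rewrite tofrac_eq0; apply: contraTneq ub => ->; rewrite unitr0.
have tm0 : tofrac t ^ m != 0 by rewrite expfz_neq0.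
by apply/eqP; rewrite eqr_div // -zE zE' mulrC.
Qed.

Lemma has_order_uniq z m n : has_order t z m -> has_order t z n -> m = n.
Proof.
move=> zm zn; apply/eqP.
by rewrite eq_le (has_order_le zm zn) (has_order_le zn zm).
Qed.

Lemma has_order_tofrac_ge0 z n :
  has_order t z n -> 0 <= n -> exists a, tofrac a = z.
Proof.
case: n => [k|//] [u _ ->] _; exists (u * t ^+ k).
by rewrite tofracM tofracXn.
Qed.

(** Factor out the smaller power of [t]: the cofactor lies in [R]. *)
Lemma has_orderD z w m n k :
  has_order t z m -> has_order t w n -> has_order t (z + w) k ->
  m <= n -> m <= k.
Proof.
move=> zm wn zwk mn; have tm : has_order t (tofrac t ^ m) m.
  by exists 1; rewrite ?unitr1 // rmorph1 mul1r.
have [a aE] : exists a, tofrac a = z * (tofrac t ^ m)^-1.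
  apply: has_order_tofrac_ge0 (has_orderM zm (has_orderV tm)) _.
  by rewrite subrr.
have [b bE] : exists b, tofrac b = w * (tofrac t ^ m)^-1.
  apply: has_order_tofrac_ge0 (has_orderM wn (has_orderV tm)) _.
  by rewrite subr_ge0.
rewrite -subr_ge0; apply: (@has_order_ge0 (a + b)).
by rewrite tofracD aE bE -mulrDl; apply: has_orderM (has_orderV tm).
Qed.

Lemma uniformizer_dvr : is_dvr R.
Proof.
pose v (z : {fraction R}) : int := xget 0 (has_order t z).
have vP z : z != 0 -> has_order t z (v z).
  by move=> /has_order_ex; apply: xgetPex.
have vE z n : z != 0 -> has_order t z n -> v z = n.
  by move=> z0; apply: has_order_uniq; apply: vP.
exists {fraction R}, v, tofrac; split.
- split=> [z w z0 w0|n|z w z0 w0 zw0].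
  + by apply: vE; [rewrite mulf_neq0|apply: has_orderM; apply: vP].
  + exists (tofrac t ^ n); first by rewrite expfz_neq0.
    apply: vE; first by rewrite expfz_neq0.
    by exists 1; rewrite ?unitr1 // rmorph1 mul1r.
  + rewrite ge_min; case: (lerP (v z) (v w)) => [le_zw|/ltW le_wz].
      by rewrite (has_orderD (vP z z0) (vP w w0) (vP _ zw0)).
    rewrite addrC in zw0 *; apply/orP; right.
    exact: has_orderD (vP w w0) (vP z z0) (vP _ zw0) le_wz.
- by move=> a b /eqP; rewrite tofrac_eq => /eqP.
- apply/seteqP; split=> [_ [a _ <-]|z].
    have [->|a0] := eqVneq a 0; first by left; rewrite rmorph0.
    by right; apply: (@has_order_ge0 a); apply: vP; rewrite tofrac_eq0.
  have [-> _|z0 [z00|vz]] := eqVneq z 0; first by exists 0; rewrite ?rmorph0.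
    by rewrite z00 eqxx in z0.
  by have [a aE] := has_order_tofrac_ge0 (vP z z0) vz; exists a.
Qed.

End Order.

Theorem proposition14 (R : idomainType) :
  is_dvr R <-> is_strongly_local R /\ is_noetherian R.
Proof.
split=> [/dvr_uniformizer [t ut]|[sl noeth]].
  split; first exact: uniformizer_strongly_local ut.
  exact: uniformizer_noetherian ut.
have [t ut] := strongly_local_uniformizer sl noeth.
exact: uniformizer_dvr ut.
Qed.
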